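(* Let $G=(E,\mathcal E)$ be a reflexive directed graph equipped with the zigzag distance $d_G$. The following properties are equivalent: (i) $G$ is isometrically embeddable into a product of reflexive and oriented zigzags; (ii) $G$ is isometrically embeddable into a power of $G_{\mathcal N_\Lambda}$; (iii) the values $d_G(x,y)$, $x,y\in E$, of the zigzag distance belong to $\mathcal N_\Lambda$.
   Context: A directed graph is a pair $(E,\mathcal E)$ with $\mathcal E\subseteq E\times E$; it is reflexive if it contains all loops, oriented if $\mathcal E$ is antisymmetric. Homomorphisms are edge-preserving maps. Products of graphs are taken coordinatewise (a pair is an edge iff it is an edge in each coordinate), over arbitrary index sets; a power of $H$ is a product of copies of $H$. Let $\Lambda=\{+,-\}$ and let $\Lambda^*$ be the set of finite words over $\Lambda$, including the empty word $\Box$, ordered by the subword ordering: $u\le v$ iff $u$ is obtained from $v$ by deleting letters. Let $\overline{+}=-$, $\overline{-}=+$, $\overline{\Box}=\Box$, $\overline{u_0\cdots u_{n-1}}=\overline{u_{n-1}}\cdots\overline{u_0}$. For a word $u=\alpha_0\cdots\alpha_{n-1}$ of length $\ell(u)=n$, $L_u$ is the reflexive graph on $\{0,\dots,n\}$ whose non-loop edges are $(i,i+1)$ when $\alpha_i=+$ and $(i+1,i)$ when $\alpha_i=-$. A reflexive oriented zigzag is a graph isomorphic to some $L_u$. For a reflexive directed graph $G=(E,\mathcal E)$ and $x,y\in E$, the zigzag distance $d_G(x,y)$ is the set of words $u\in\Lambda^*$ for which there is a homomorphism $h:L_u\to G$ with $h(0)=x$ and $h(\ell(u))=y$. $G$ is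 isometrically embeddable into $H$ if there is a map $f$ from the vertices of $G$ to those of $H$ with $d_H(f(x),f(y))=d_G(x,y)$ for all $x,y$. For $Y\subseteq\Lambda^*$ let $Y^{\Delta}=\{w\in\Lambda^*: y\le w\text{ for all }y\in Y\}$. $\mathcal N_\Lambda$ is the set $\{Y^\Delta:Y\subseteq\Lambda^*\}$ ordered by reverse inclusion ($p\le q$ iff $p\supseteq q$); it is a complete lattice, closed under concatenation $p\oplus q=\{uv:u\in p,v\in q\}$ and under the involution $\overline p=\{\overline u:u\in p\}$. For $p,q\in\mathcal N_\Lambda$, $d_{\mathcal N_\Lambda}(p,q)$ denotes the least $r\in\mathcal N_\Lambda$ such that $p\le q\oplus\overline r$ and $q\le p\oplus r$. $G_{\mathcal N_\Lambda}$ is the reflexive directed graph with vertex set $\mathcal N_\Lambda$ in which $(p,q)$ is an edge iff the one-letter word $+$ belongs to $d_{\mathcal N_\Lambda}(p,q)$; $d_{\mathcal N_\Lambda}$ is the zigzag distance of this graph. *)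

(* Defs.v *)
From mathcomp Require Import all_boot.
From mathcomp Require Import boolp classical_sets.

Set Implicit Arguments.
Unset Strict Implicit.
Unset Printing Implicit Defensive.

Local Open Scope classical_set_scope.

Record digraph := Digraph {
  vertex :> Type;
  edge : vertex -> vertex -> Prop
}.

Definition reflexive_graph (G : digraph) : Prop := forall x : G, edge x x.

Definition graph_hom (G H : digraph) (f : G -> H) : Prop :=
  forall x y : G, edge x y -> edge (f x) (f y).

Definition isomorphic (G H : digraph) : Prop :=
  exists2 f : G -> H, bijective f &
    forall x y : G, edge x y <-> edge (f x) (f y).

Definition prod_graph (I : Type) (H : I -> digraph) : digraph :=
  @Digraph (forall i, H i) (fun x y => forall i, edge (x i) (y i)).

Definition power_graph (H : digraph) (I : Type) : digraph :=
  prod_graph (fun _ : I => H).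

(* The subword ordering on words is mathcomp's [subseq]. *)
Definition letter := bool.
Definition plus : letter := true.
Definition minus : letter := false.
Definition word := seq letter.

Definition bar (u : word) : word := rev (map negb u).

Definition zigzag_edge (u : word) (i j : 'I_(size u).+1) : Prop :=
  [\/ i = j,
      j = i.+1 :> nat /\ nth plus u i = plus |
      i = j.+1 :> nat /\ nth plus u j = minus].

Definition zigzag (u : word) : digraph := Digraph (@zigzag_edge u).

Definition is_zigzag (H : digraph) : Prop := exists u, isomorphic (zigzag u) H.

Definition zdist (G : digraph) (x y : G) : set word :=
  [set u | exists h : zigzag u -> G,
             [/\ graph_hom h, h ord0 = x & h ord_max = y]].

Definition isometrically_embeddable (G H : digraph) : Prop :=
  exists f : G -> H, forall x y : G, zdist (f x) (f y) = zdist x y.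

Definition upper_cone (Y : set word) : set word :=
  [set w | forall y, Y y -> subseq y w].

Definition NLambda : set (set word) := range upper_cone.

(* [NLambda] is ordered by reverse inclusion. *)
Definition leN (p q : set word) : Prop := q `<=` p.

Definition oplus (p q : set word) : set word :=
  [set w | exists u v, [/\ p u, q v & w = u ++ v]].

Definition barN (p : set word) : set word := bar @` p.

Definition distN_bound (p q r : set word) : Prop :=
  [/\ NLambda r, leN p (oplus q (barN r)) & leN q (oplus p r)].

(* [r] is d(p, q), the least element of [NLambda] satisfying both
   inequalities. *)
Definition is_distN (p q r : set word) : Prop :=
  distN_bound p q r /\ forall s, distN_bound p q s -> leN r s.

Definition GN : digraph :=
  @Digraph {p : set word | NLambda p}
    (fun p q => exists2 r, is_distN (sval p) (sval q) r & r [:: plus]).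

(* Main.v *)
(** Over a reflexive graph, [zdist x y] is the set of labels of walks from [x]
    to [y].

    For [p] in [NLambda] the quotients [{w | v w \in p}] and [{w | w v \in p}]
    are in [NLambda] as well, because the condition [y <= v w] on [w] says that
    what is left of [y] after matching it greedily against [v] is a subword of
    [w].  Hence the largest set [r] with [p r] included in [q] and [q (bar r)]
    in [p] is in [NLambda], and a word [a w] of [d(p, q)] factors through the
    smallest element of [NLambda] containing [p a] and [q (bar w)]; so d is the
    zigzag distance of [GN], and [x |-> d_G(-, x)] embeds [G] in a power of [GN]
    as soon as [d_G] takes its values in [NLambda].

    In [L_u] the distance between two vertices is the principal final segment of
    the factor of [u] between them.  Conversely, if all words of [d_G(x, y)]
    contain [u], then sending [z] to the length of the longest prefix of [u]
    which is contained in all words of [d_G(x, z)] is a homomorphism from [G] to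
    [L_u] mapping [x] and [y] to the two ends. *)

Require Import Defs.
From mathcomp Require Import all_boot zify.
From mathcomp Require Import boolp classical_sets.

Set Implicit Arguments.
Unset Strict Implicit.
Unset Printing Implicit Defensive.

Local Open Scope classical_set_scope.

(** * The involution and the subword ordering on words *)

Lemma bar_cat (u v : word) : bar (u ++ v) = bar v ++ bar u.
Proof. by rewrite /bar map_cat rev_cat. Qed.

Lemma barK : involutive bar.
Proof. by move=> u; rewrite /bar map_rev revK (mapK negbK). Qed.

Lemma subseq_bar (u v : word) : subseq (bar u) (bar v) = subseq u v.
Proof.
have sub_bar (s t : word) : subseq s t -> subseq (bar s) (bar t).
  by move=> st; rewrite /bar subseq_rev map_subseq.
by apply/idP/idP => /sub_bar; rewrite ?barK.
Qed.

(** Greedy matching may as well start from the last letters, which suits walks extended at their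
    end. *)
Lemma subseq_rcons2 (T : eqType) (s t : seq T) (a b : T) :
  subseq (rcons s a) (rcons t b) =
  if a == b then subseq s t else subseq (rcons s a) t.
Proof.
rewrite -subseq_rev !rev_rcons /=.
by case: eqP => _; rewrite -?rev_rcons subseq_rev.
Qed.

(** The remainder of [y] once the letters of [v] have been used up greedily from the left. *)
Fixpoint residual (y v : word) : word :=
  if v is a :: v' then
    if y is b :: y' then residual (if b == a then y' else y) v' else [::]
  else y.

Lemma subseq_residual (y v w : word) :
  subseq y (v ++ w) = subseq (residual y v) w.
Proof.
elim: v y => [|a v IHv] [|b y] //=; by rewrite sub0seq.
Qed.

(** * Closure properties of [NLambda] *)

Lemma NLambda_subseq (p : set word) (u v : word) :
  NLambda p -> subseq u v -> p u -> p v.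
Proof. by case=> Y _ <- uv pu y /pu yu; exact: subseq_trans uv. Qed.

Lemma NLambda_principal (v : word) : NLambda [set w | subseq v w].
Proof. by exists [set v] => //; apply/seteqP; split=> w /= => [|vw _ ->] //; exact. Qed.

Lemma NLambda_forall (I : Type) (P : I -> Prop) (F : I -> set word) :
  (forall i, NLambda (F i)) -> NLambda [set w | forall i, P i -> F i w].
Proof.
move=> NF; have /choice[Y YF] i : exists Y, upper_cone Y = F i.
  by case: (NF i) => Y _ <-; exists Y.
exists [set y | exists2 i, P i & Y i y] => //.
apply/seteqP; split=> w /= Yw.
  by move=> i Pi; rewrite -YF => y Yy; apply: Yw; exists i.
by move=> y [i Pi Yy]; move: (Yw i Pi); rewrite -YF; apply.
Qed.

Lemma NLambdaI (p q : set word) : NLambda p -> NLambda q -> NLambda (p `&` q).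
Proof.
move=> [Y _ <-] [Z _ <-]; exists (Y `|` Z) => //.
apply/seteqP; split=> w /= => [YZw|[Yw Zw] y [/Yw|/Zw]//].
by split=> y Yy; apply: YZw; [left|right].
Qed.

Lemma NLambda_quotl (p : set word) (v : word) :
  NLambda p -> NLambda [set w | p (v ++ w)].
Proof.
move=> [Y _ <-]; exists (residual^~ v @` Y) => //.
apply/seteqP; split=> w /= Yw.
  by move=> y Yy; rewrite subseq_residual; apply: Yw; exists y.
by move=> _ [y Yy <-]; rewrite -subseq_residual; exact: Yw.
Qed.

Lemma NLambda_bar (p : set word) : NLambda p -> NLambda [set w | p (bar w)].
Proof.
move=> [Y _ <-]; exists (bar @` Y) => //.
apply/seteqP; split=> w /= Yw.
  by move=> y Yy; rewrite -subseq_bar barK; apply: Yw; exists y.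
by move=> _ [y Yy <-]; rewrite -subseq_bar barK; exact: Yw.
Qed.

Lemma NLambda_quotr (p : set word) (v : word) :
  NLambda p -> NLambda [set w | p (w ++ v)].
Proof.
move=> /NLambda_bar/(NLambda_quotl (bar v))/NLambda_bar; congr NLambda.
by apply/seteqP; split=> w /=; rewrite bar_cat !barK.
Qed.

(** The closure operator of the Galois connection between lower and upper bounds: the smallest
    element of [NLambda], for inclusion, that contains [S]. *)
Definition hullN (S : set word) : set word :=
  upper_cone [set y | forall w, S w -> subseq y w].

Lemma NLambda_hullN (S : set word) : NLambda (hullN S).
Proof. by exists [set y | forall w, S w -> subseq y w]. Qed.

Lemma sub_hullN (S : set word) : S `<=` hullN S.
Proof. by move=> w Sw y; exact. Qed.

Lemma hullN_sub (S p : set word) : NLambda p -> S `<=` p -> hullN S `<=` p.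
Proof. by move=> [Y _ <-] Sp w Sw y Yy; apply: Sw => v /Sp; exact. Qed.

(** * The distance on [NLambda] and its splitting property *)

Definition distN (p q : set word) : set word :=
  [set w | (forall v, p v -> q (v ++ w)) /\ (forall v, q v -> p (v ++ bar w))].

Lemma NLambda_distN (p q : set word) :
  NLambda p -> NLambda q -> NLambda (distN p q).
Proof.
move=> Np Nq; apply: NLambdaI.
  by apply: NLambda_forall => v; exact: NLambda_quotl.
by apply: NLambda_forall => v; exact: (NLambda_bar (NLambda_quotl v Np)).
Qed.

Lemma is_distNE (p q r : set word) :
  NLambda p -> NLambda q -> is_distN p q r <-> r = distN p q.
Proof.
move=> Np Nq.
have bd : distN_bound p q (distN p q).
  split; first exact: NLambda_distN.
  - by move=> _ [v [_ [qv [w [_ wP] <-] ->]]]; exact: wP.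
  - by move=> _ [v [w [pv [wP _] ->]]]; exact: wP.
(* Under reverse inclusion the least bound is the largest one as a set. *)
have max_distN s : distN_bound p q s -> s `<=` distN p q.
  move=> [_ qsp psq] w sw; split=> v pv; last by apply: qsp; exists v, (bar w); split=> //; exists w.
  by apply: psq; exists v, w.
split=> [[bdr leastr]|->]; last by split.
by apply/seteqP; split; [exact: max_distN|exact: leastr].
Qed.

Lemma distN_bar (p q : set word) (w : word) : distN p q (bar w) = distN q p w.
Proof. by apply/propext; rewrite /distN /= barK; split=> -[]. Qed.

Lemma distN_nil (p q : set word) : distN p q [::] <-> p = q.
Proof.
split=> [[pq qp]|->]; last by split=> v; rewrite cats0.
by apply/seteqP; split=> v => [/pq|/qp]; rewrite cats0.
Qed.

Lemma distN_cat (p q r : set word) (u v : word) :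
  distN p r u -> distN r q v -> distN p q (u ++ v).
Proof.
move=> [pr rp] [rq qr]; split=> w; first by move=> /pr/rq; rewrite catA.
by move=> /qr/rp; rewrite bar_cat catA.
Qed.

Lemma distN_split (p q : set word) (u v : word) :
  NLambda p -> NLambda q -> distN p q (u ++ v) ->
  exists r, [/\ NLambda r, distN p r u & distN r q v].
Proof.
move=> Np Nq [pq qp].
pose S := [set w | (exists2 s, p s & w = s ++ u) \/
                   (exists2 s, q s & w = s ++ bar v)].
exists (hullN S); split; first exact: NLambda_hullN.
- split=> [s ps|]; first by apply: sub_hullN; left; exists s.
  (* The words [w] with [w ++ bar u] in [p] form an element of [NLambda], so the generators of the
     hull suffice: [s ++ u ++ bar u] contains [s], and [bar v ++ bar u] is [bar (u ++ v)]. *)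
  apply: (hullN_sub (NLambda_quotr (bar u) Np)) => _ [] [s ps ->] /=.
    by apply: NLambda_subseq ps => //; rewrite -catA prefix_subseq.
  by rewrite -catA -bar_cat; exact: qp.
- split=> [|s qs]; last by apply: sub_hullN; right; exists s.
  apply: (hullN_sub (NLambda_quotr v Nq)) => _ [] [s ps ->] /=.
    by rewrite -catA; exact: pq.
  by apply: NLambda_subseq ps => //; rewrite -catA prefix_subseq.
Qed.

(** * Walks and the zigzag distance *)

Definition step (G : digraph) (a : letter) (x y : G) : Prop :=
  if a then edge x y else edge y x.

(** Recursion on the word replaces homomorphisms out of [zigzag w], whose vertex type depends on
    [size w]. *)
Fixpoint walk (G : digraph) (w : word) (x y : G) : Prop :=
  if w is a :: w' then exists2 z, step a x z & walk w' z y else x = y.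

Lemma step_negb (G : digraph) (a : letter) (x y : G) :
  step (~~ a) x y = step a y x.
Proof. by case: a. Qed.

Lemma step_hom (G H : digraph) (f : G -> H) (a : letter) (x y : G) :
  graph_hom f -> step a x y -> step a (f x) (f y).
Proof. by case: a => fP; exact: fP. Qed.

Lemma walk1 (G : digraph) (a : letter) (x y : G) :
  walk [:: a] x y <-> step a x y.
Proof. by split=> [[z xz <-]|xy] //; exists y. Qed.

Lemma walk_cat (G : digraph) (u v : word) (x y z : G) :
  walk u x y -> walk v y z -> walk (u ++ v) x z.
Proof.
by elim: u x => [x <-|a u IHu x [t xt ty] yz] //=; exists t => //; exact: IHu.
Qed.

Lemma walk_bar (G : digraph) (w : word) (x y : G) :
  walk w x y -> walk (bar w) y x.
Proof.
elim: w x => [x <-|a w IHw x [z xz /IHw zy]] //.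
rewrite -cat1s bar_cat; apply: walk_cat zy _.
by apply/walk1; rewrite step_negb.
Qed.

Lemma walk_hom (G H : digraph) (f : G -> H) (w : word) (x y : G) :
  graph_hom f -> walk w x y -> walk w (f x) (f y).
Proof.
move=> fP; elim: w x => [x <-|a w IHw x [z xz /IHw zy]] //=.
by exists (f z) => //; exact: step_hom.
Qed.

(** Surplus letters of [v] are spent on loops. *)
Lemma walk_subseq (G : digraph) (u v : word) (x y : G) :
  reflexive_graph G -> subseq u v -> walk u x y -> walk v x y.
Proof.
move=> Gr; elim: v u x => [|b v IHv] u x; first by rewrite subseq0 => /eqP->.
have loop : step b x x by case: b; exact: Gr.
case: u => [_ xy|a u] /=; first by exists x => //; exact: (IHv [::] x (sub0seq v)).
case: eqP => [->|_] uv; first by case=> z xz zy; exists z => //; exact: (IHv u).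
by move=> w_xy; exists x => //; exact: (IHv (a :: u)).
Qed.

Lemma walk_nth (G : digraph) (u : word) (x y : G) :
  walk u x y <->
  exists h : nat -> G, [/\ h 0 = x, h (size u) = y &
    forall i, i < size u -> step (nth plus u i) (h i) (h i.+1)].
Proof.
elim: u x => [|a u IHu] x /=.
  by split=> [<-|[h [-> ->]]] //; exists (fun=> x).
split=> [[z xz /IHu[h [h0 hn hP]]]|[h [h0 hn hP]]].
  exists (fun n => if n is m.+1 then h m else x); split=> // -[_|i]; last exact: hP.
  by rewrite h0.
exists (h 1); first by rewrite -h0; exact: (hP 0).
by apply/IHu; exists (h \o succn); split=> // i; exact: (hP i.+1).
Qed.

Lemma zdistE (G : digraph) (x y : G) :
  reflexive_graph G -> zdist x y = [set w | walk w x y].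
Proof.
move=> Gr; apply/seteqP; split=> u /=.
  move=> [h [hP <- <-]]; apply/walk_nth; exists (fun i => h (inord i)); split.
  - by congr h; apply/val_inj; rewrite /= inordK.
  - by congr h; apply/val_inj; rewrite /= inordK.
  move=> i iu; case ui : (nth plus u i) => /=; apply: hP.
    by apply: Or32; rewrite !inordK // ltnS ltnW.
  by apply: Or33; rewrite !inordK // ltnS ltnW.
move=> /walk_nth[h [<- <- hP]]; exists (fun i : 'I_(size u).+1 => h i); split=> // i j.
have [ltiu ltju] := (ltn_ord i, ltn_ord j).
case=> [->|[ji ui]|[ij uj]] /=; first exact: Gr.
  by move: (hP i); rewrite ui -ji -ltnS; exact.
by move: (hP j); rewrite uj -ij -ltnS; exact.
Qed.

Lemma reflexive_prod_graph (I : Type) (H : I -> digraph) :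
  (forall i, reflexive_graph (H i)) -> reflexive_graph (prod_graph H).
Proof. by move=> Hr x i; exact: Hr. Qed.

Lemma step_prod (I : Type) (H : I -> digraph) (a : letter) (x y : prod_graph H) :
  step a x y <-> forall i, step a (x i) (y i).
Proof. by case: a. Qed.

Lemma walk_prod (I : Type) (H : I -> digraph) (w : word) (x y : prod_graph H) :
  walk w x y <-> forall i, walk w (x i) (y i).
Proof.
elim: w x => [|a w IHw] x /=.
  by split=> [-> //|xy]; exact: functional_extensionality_dep.
split=> [[z /step_prod xz /IHw zy] i|xy]; first by exists (z i).
(* The coordinates share the word but not the intermediate vertex, so one is chosen in each
   coordinate. *)
pose z i := s2val (cid2 (xy i)).
exists z; first by apply/step_prod => i; rewrite /z; case: cid2.
by apply/IHw => i; rewrite /z; case: cid2.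
Qed.

Lemma NLambda_zdist_prod (I : Type) (H : I -> digraph) (x y : prod_graph H) :
  (forall i, reflexive_graph (H i)) ->
  (forall i, NLambda (zdist (x i) (y i))) -> NLambda (zdist x y).
Proof.
move=> Hr Nxy; rewrite zdistE; last exact: reflexive_prod_graph.
have := NLambda_forall (fun=> True) Nxy; congr NLambda.
apply/seteqP; split=> w /=.
  by move=> xyw; apply/walk_prod => i; move: (xyw i Logic.I); rewrite zdistE.
by move=> /walk_prod xyw i _; rewrite zdistE.
Qed.

(** * The graph [GN] and the embedding into its powers *)

Lemma stepGN (a : letter) (p q : GN) :
  step a p q <-> distN (sval p) (sval q) [:: a].
Proof.
have edgeGN (r s : GN) : edge r s <-> distN (sval r) (sval s) [:: plus].
  split=> [[d /is_distNE->]|rs]; try exact: svalP; first exact.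
  by exists (distN (sval r) (sval s)) => //; apply/is_distNE; try exact: svalP.
by case: a; rewrite /step edgeGN // -distN_bar.
Qed.

Lemma walkGN (w : word) (p q : GN) :
  walk w p q <-> distN (sval p) (sval q) w.
Proof.
elim: w p => [|a w IHw] p /=.
  rewrite distN_nil; split=> [-> //|].
  by case: p q => p Np [q Nq] /=; exact: eq_exist.
split=> [[r /stepGN pr /IHw rq]|]; first exact: (distN_cat pr rq).
rewrite -cat1s => /distN_split[||r [Nr pr rq]]; try exact: svalP.
by exists (exist _ r Nr); [exact/stepGN|exact/IHw].
Qed.

Lemma reflexive_GN : reflexive_graph GN.
Proof.
move=> [p Np]; apply/(stepGN plus) => /=; split=> v;
  by apply: NLambda_subseq => //; exact: prefix_subseq.
Qed.

Lemma zdistGN (p q : GN) : zdist p q = distN (sval p) (sval q).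
Proof.
by rewrite zdistE; [apply/seteqP; split=> w /walkGN|exact: reflexive_GN].
Qed.

Lemma embed_powerGN (G : digraph) :
  reflexive_graph G -> (forall x y : G, NLambda (zdist x y)) ->
  isometrically_embeddable G (power_graph GN G).
Proof.
move=> Gr NG; exists (fun x z => exist _ (zdist z x) (NG z x)) => x y.
rewrite !zdistE //; last by apply: reflexive_prod_graph => _; exact: reflexive_GN.
apply/seteqP; split=> w /=.
  (* The coordinate at [x] suffices, since the empty word lies in [zdist x x]. *)
  move=> /walk_prod/(_ x)/walkGN/=; rewrite !zdistE // => -[xx_xy _].
  exact: (xx_xy [::]).
move=> xyw; apply/walk_prod => z; apply/walkGN; rewrite /= !zdistE //.
split=> v /= /walk_cat; apply => //.
exact: walk_bar.
Qed.

(** * Distances inside a zigzag *)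

Lemma reflexive_zigzag (u : word) : reflexive_graph (zigzag u).
Proof. by move=> i; apply: Or31. Qed.

(** A step climbs by at most one position, and if it climbs, its letter is the letter of [u] that it
    crosses; otherwise the prefix does not grow. *)
Lemma zigzag_step_subseq (u : word) (a : letter) (i j : zigzag u) :
  step a i j -> subseq (take j u) (rcons (take i u) a).
Proof.
have prefix_case (k l : nat) b : k <= l -> subseq (take k u) (rcons (take l u) b).
  move=> kl; apply: subseq_trans (subseq_rcons _ _).
  by rewrite -(take_takel u kl) take_subseq.
have succ_case (k l : zigzag u) :
    l = k.+1 :> nat -> subseq (take l u) (rcons (take k u) (nth plus u k)).
  by move=> lk; rewrite lk (take_nth plus) // -ltnS -lk.
case: a => /= -[ij|[ij uij]|[ij uij]];
  do ?by apply: prefix_case; rewrite ij.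
- by have := succ_case _ _ ij; rewrite uij.
- by have := succ_case _ _ ij; rewrite uij.
Qed.

Lemma zigzag_walk_subseq (u w : word) (i j : zigzag u) :
  walk w i j -> subseq (take j u) (take i u ++ w).
Proof.
elim: w i => [i ->|a w IHw i [k /zigzag_step_subseq ik /IHw]]; first by rewrite cats0.
by move=> /subseq_trans; apply; rewrite -cat_rcons cat_subseq.
Qed.

(** Climbing one position at a time reads off the letters of [u]. *)
Lemma zigzag_walk_factor (u : word) (i j : zigzag u) :
  i <= j -> walk (drop i (take j u)) i j.
Proof.
have ju : j <= size u by rewrite -ltnS.
have [n] := ubnP (j - i); elim: n i => // n IHn i.
rewrite ltnS => jin; rewrite leq_eqVlt => /predU1P[ij|ij].
  have -> : i = j by exact: val_inj.
  by rewrite drop_oversize // size_take_min geq_minl.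
have iu : i.+1 < (size u).+1 by rewrite ltnS (leq_trans ij).
rewrite (drop_nth plus) ?size_takel //= nth_take //.
exists (Ordinal iu); last by apply: IHn => //=; lia.
by case ui : (nth plus u i); [apply: Or32|apply: Or33].
Qed.

Lemma zdist_zigzag (u : word) (i j : zigzag u) :
  i <= j -> zdist i j = [set w | subseq (drop i (take j u)) w].
Proof.
move=> ij; rewrite zdistE; last exact: reflexive_zigzag.
apply/seteqP; split=> w /=; last first.
  move=> uw; apply: walk_subseq uw _; first exact: reflexive_zigzag.
  exact: zigzag_walk_factor.
move=> /zigzag_walk_subseq.
rewrite -{1}(cat_take_drop i (take j u)) take_takel //.
by rewrite subseq_cat2l.
Qed.

Lemma zdist_bar (G : digraph) (x y : G) :
  reflexive_graph G -> zdist x y = [set w | zdist y x (bar w)].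
Proof.
move=> Gr; rewrite !zdistE //; apply/seteqP; split=> w /= /walk_bar //.
by rewrite barK.
Qed.

Lemma NLambda_zdist_zigzag (u : word) (i j : zigzag u) : NLambda (zdist i j).
Proof.
have [ij|/ltnW ji] := leqP i j.
  by rewrite zdist_zigzag //; exact: NLambda_principal.
rewrite zdist_bar; last exact: reflexive_zigzag.
by rewrite (zdist_zigzag ji); exact/NLambda_bar/NLambda_principal.
Qed.

Lemma is_zigzag_reflexive (H : digraph) : is_zigzag H -> reflexive_graph H.
Proof.
move=> [u [f [g fK gK] fP]] x.
by rewrite -(gK x); apply/fP; exact: reflexive_zigzag.
Qed.

Lemma NLambda_zdist_is_zigzag (H : digraph) (x y : H) :
  is_zigzag H -> NLambda (zdist x y).
Proof.
move=> Hz; have Hr := is_zigzag_reflexive Hz; case: Hz => u [f [g fK gK] fP].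
have := NLambda_zdist_zigzag (g x) (g y); congr NLambda.
rewrite !zdistE //; last exact: reflexive_zigzag.
apply/seteqP; split=> w /=; last by apply: walk_hom => s t; rewrite fP !gK.
by rewrite -{2}(gK x) -{2}(gK y); apply: walk_hom => s t /fP.
Qed.

(** * Homomorphisms to zigzags from common prefixes *)

Definition common_prefix (G : digraph) (x : G) (u : word) (z : G) (k : nat) : Prop :=
  forall w, walk w x z -> subseq (take k u) w.

Lemma exists_max_common_prefix (G : digraph) (x : G) (u : word) (z : G) :
  exists k : 'I_(size u).+1, common_prefix x u z k /\
    forall l : nat, k < l <= size u -> ~ common_prefix x u z l.
Proof.
pose P k := (k <= size u) && `[< common_prefix x u z k >].
have P0 : exists k, P k.
  by exists 0; apply/asboolP => w _; rewrite take0 sub0seq.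
have Pub k : P k -> k <= size u by case/andP.
case: (ex_maxnP P0 Pub) => k /andP[ku /asboolP Pk] kmax.
exists (Ordinal (ku : k < (size u).+1)); split=> // l /andP[kl lu] Pl.
by have := kmax l; rewrite /P lu leqNgt kl; move/asboolP : Pl => -> /(_ isT).
Qed.

Lemma exists_hom_zigzag (G : digraph) (x y : G) (u : word) :
  (forall w, walk w x y -> subseq u w) ->
  exists f : G -> zigzag u, [/\ graph_hom f, f x = ord0 & f y = ord_max].
Proof.
move=> xyu; have [f fP] := choice (exists_max_common_prefix x u).
(* Where [f] increases, a walk to [z] missing the prefix of length [f z + 1] acquires the prefix of
   length [f t] by one more letter; that letter can only supply the next letter of [u]. *)
have fstep a z t : step a z t -> f z < f t ->
    f t = (f z).+1 :> nat /\ nth plus u (f z) = a.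
  move=> zt ltzt; have ftu : f t <= size u by rewrite -ltnS.
  have fzu : f z < size u by exact: leq_trans ftu.
  have [w xzw] : exists2 w, walk w x z & ~~ subseq (take (f z).+1 u) w.
    apply: contrapT => nw; apply: (proj2 (fP z) (f z).+1); first by rewrite ltnSn.
    by move=> w xz; apply: contrapT => /negP uw; apply: nw; exists w.
  move=> nuw.
  have uwa : subseq (take (f t) u) (rcons w a).
    by apply: (proj1 (fP t)); rewrite -cats1; apply: walk_cat xzw _; exact/walk1.
  have shorter k : k <= f t -> subseq (take k u) (rcons w a).
    by move=> kt; apply: subseq_trans uwa; rewrite -(take_takel u kt) take_subseq.
  have := shorter _ ltzt; rewrite (take_nth plus) // subseq_rcons2.
  case: eqP => [ua _|_]; last by rewrite -take_nth // (negPf nuw).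
  (* An increase of two or more would leave the prefix of length [f z + 1] inside [w] once the last
     letters are dropped, against the choice of [w]. *)
  split=> //; apply/eqP; rewrite eqn_leq ltzt andbT leqNgt; apply/negP => lt2.
  have := shorter _ lt2; rewrite (take_nth plus) ?subseq_rcons2; last exact: leq_trans ftu.
  case: ifP => _; first by rewrite (negPf nuw).
  move=> /(subseq_trans (subseq_rcons _ _)).
  by rewrite (negPf nuw).
exists f; split.
- move=> z t zt; case: (ltngtP (f z) (f t)) => [lt|lt|/val_inj eq_zt].
  + by apply: Or32; exact: (fstep plus).
  (* A decrease is an increase along the reversed step, whose letter is [minus]. *)
  + by apply: Or33; exact: (fstep minus).
  + exact: Or31.
(* The empty walk at [x] leaves only the empty prefix. *)
- apply/val_inj/eqP; have := proj1 (fP x) [::] erefl; rewrite subseq0.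
  by rewrite -size_eq0 size_takel // -ltnS.
(* A value below [size u] contradicts maximality, since every walk from [x] to [y] contains all of
   [u]. *)
- apply/val_inj/eqP; rewrite eqn_leq /= -ltnS ltn_ord leqNgt; apply/negP => fyu.
  apply: (proj2 (fP y) (size u)); first by rewrite fyu leqnn.
  by move=> w /xyu; rewrite take_size.
Qed.

Lemma embed_prod_zigzag (G : digraph) :
  reflexive_graph G -> (forall x y : G, NLambda (zdist x y)) ->
  exists (I : Type) (H : I -> digraph),
    (forall i, is_zigzag (H i)) /\ isometrically_embeddable G (prod_graph H).
Proof.
move=> Gr NG.
(* One zigzag per pair of vertices and common subword of the walks between them: an element of
   [NLambda] is determined by its lower bounds. *)
pose I := {t : G * G * word | forall w, walk w t.1.1 t.1.2 -> subseq t.2 w}.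
pose f (i : I) := cid (exists_hom_zigzag (svalP i)).
exists I, (fun i => zigzag (sval i).2); split.
  by move=> i; exists (sval i).2, id; [exists id|move=> x y; split].
exists (fun x i => sval (f i) x) => x y.
rewrite !zdistE //; last by apply: reflexive_prod_graph => i; exact: reflexive_zigzag.
apply/seteqP; split=> w /=; last first.
  move=> xyw; apply/walk_prod => i; case: (f i) => g [gP _ _] /=.
  exact: walk_hom.
move=> /walk_prod xyw; have [Y _ Yxy] := NG x y.
rewrite zdistE // in Yxy; suff : upper_cone Y w by rewrite Yxy.
move=> u Yu; have xyu v : walk v x y -> subseq u v.
  by move=> xyv; have /(_ u Yu) : upper_cone Y v by rewrite Yxy.
(* In the coordinate of [(x, y, u)] the walk runs from end to end of the zigzag, so its word
   contains [u]. *)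
move: (xyw (exist _ (x, y, u) xyu)); case: (f _) => g [_ /= -> ->].
move=> /zigzag_walk_subseq /=.
by rewrite take_size take0.
Qed.

Theorem theorem5p21 (G : digraph) (hG : reflexive_graph G) :
  ((exists (I : Type) (H : I -> digraph),
      (forall i, is_zigzag (H i)) /\
      isometrically_embeddable G (prod_graph H))
   <->
   (exists I : Type, isometrically_embeddable G (power_graph GN I)))
  /\
  ((exists I : Type, isometrically_embeddable G (power_graph GN I))
   <->
   (forall x y : G, NLambda (zdist x y))).
Proof.
have i_iii : (exists (I : Type) (H : I -> digraph), (forall i, is_zigzag (H i)) /\
      isometrically_embeddable G (prod_graph H)) ->
    forall x y : G, NLambda (zdist x y).
  move=> [I [H [Hz [f fP]]]] x y; rewrite -fP.
  apply: NLambda_zdist_prod => i; first exact: is_zigzag_reflexive.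
  exact: NLambda_zdist_is_zigzag.
have ii_iii : (exists I : Type, isometrically_embeddable G (power_graph GN I)) ->
    forall x y : G, NLambda (zdist x y).
  move=> [I [f fP]] x y; rewrite -fP.
  apply: NLambda_zdist_prod => i; first exact: reflexive_GN.
  by rewrite zdistGN; apply: NLambda_distN; exact: svalP.
have iii_ii : (forall x y : G, NLambda (zdist x y)) ->
    exists I : Type, isometrically_embeddable G (power_graph GN I).
  by move=> NG; exists G; exact: embed_powerGN.
(* Both implications between the two embeddings pass through the values of the distance. *)
split; split=> //.
- by move=> /i_iii.
- by move=> /ii_iii; exact: embed_prod_zigzag.
Qed.
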